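(* Let $\mathcal{H}$ be a hyperplane arrangement in $\mathbb{R}^d$. For $u\in \mathcal{L}(\mathcal{H})$ and $v$ a normalized valuation on the faces of $\mathcal{H}$, $$E_v(u) = \sum_{s\in \mathcal{L}(\mathcal{H}):\, s\geq u} |\mu(u,s)|\,v(s),$$ where $\mu$ is the Möbius function of $\mathcal{L}(\mathcal{H})$.
   Context: A hyperplane arrangement is a finite set of affine hyperplanes in $\mathbb{R}^d$ (the whole space, the ''degenerate hyperplane'', is also allowed as a member). $\mathcal{L}(\mathcal{H}) = \{\bigcap\mathcal{S} : \mathcal{S}\subseteq\mathcal{H},\ \bigcap\mathcal{S}\neq\varnothing\}$ is ordered by reverse inclusion; its elements are called flats. The Möbius function of a finite poset is defined by $\mu(r,s)=0$ if $r\not\le s$, $\mu(r,r)=1$, and $\mu(r,s)=-\sum_{r\le w<s}\mu(r,w)$ if $r<s$. For a flat $u$, the induced arrangement in $u$ is $\mathcal{H}^u=\{h\cap u: h\in\mathcal{H},\ h\not\supseteq u\}$ (empty intersections play no role). An open region of $\mathcal{H}^u$ is a connected component of $u\setminus\bigcup\mathcal{H}^u$, and a closed region is the closure of an open region. The open faces of $\mathcal{H}$ are the open regions of all the $\mathcal{H}^s$, $s\in\mathcal{L}(\mathcal{H})$. A normalized valuation on the faces of $\mathcal{H}$ is a function $v$ on finite unions of open faces of $\mathcal{H}$, with values in an abelian group, such that $v(A\cup B)+v(A\cap B)=v(A)+v(B)$ for any two such unions and $v(\varnothing)=0$; equivalently, $v(\varnothing)=0$ and $v(F_1\cup\cdots\cup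 F_k)=v(F_1)+\cdots+v(F_k)$ for distinct open faces $F_1,\dots,F_k$. For a flat $u$, $E_v(u)=\sum_R v(R)$, summed over the closed regions $R$ of $\mathcal{H}^u$. *)

(* Defs.v *)
From HB Require Import structures.
From mathcomp Require Import all_boot all_order all_algebra.
From mathcomp Require Import finmap.
From mathcomp Require Import all_classical all_reals all_analysis.

Set Implicit Arguments.
Unset Strict Implicit.
Unset Printing Implicit Defensive.

Import Order.TTheory GRing.Theory Num.Theory.
Import numFieldNormedType.Exports.

Local Open Scope classical_set_scope.
Local Open Scope ring_scope.

Section Mobius.
Context {disp : Order.disp_t} {T : finPOrderType disp}.
Implicit Types r s w : T.

(* The recursion is on the fuel [n]; [mobiusE] below shows that the fuel #|T|
   is enough, so that [mobius] satisfies the defining equations. *)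
Fixpoint mobius_rec (n : nat) r s : int :=
  if r == s then 1
  else if n is n'.+1 then
    if (r < s)%O then - \sum_(w : T | (r <= w < s)%O) mobius_rec n' r w else 0
  else 0.

Definition mobius r s : int := mobius_rec #|T| r s.

Lemma mobius_rec_stable n m r s :
  (#|[pred w | (w < s)%O]| <= n)%N -> (#|[pred w | (w < s)%O]| <= m)%N ->
  mobius_rec n r s = mobius_rec m r s.
Proof.
have pos x y : (x < y)%O -> (0 < #|[pred w | (w < y)%O]|)%N.
  by move=> xy; apply/card_gt0P; exists x.
elim: n m s => [|n IH] [|m] s //=; case: eqVneq => // _.
- by rewrite leqn0 => /eqP s0 _; case: ifPn => // /pos; rewrite s0.
- by move=> _; rewrite leqn0 => /eqP s0; case: ifPn => // /pos; rewrite s0.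
move=> sn sm; case: ifP => // _; congr (- _).
apply: eq_bigr => w /andP[_ ws].
have lt_card : (#|[pred x | (x < w)%O]| < #|[pred x | (x < s)%O]|)%N.
  apply: proper_card; apply/properP; split.
    by apply/fintype.subsetP => x; rewrite !inE => /lt_trans; apply.
  by exists w; rewrite !inE ?ltxx.
by apply: IH; rewrite -ltnS; apply: (leq_trans lt_card).
Qed.

Lemma mobiusE r s :
  mobius r s = if r == s then 1
               else if (r < s)%O then - \sum_(w : T | (r <= w < s)%O) mobius r w
               else 0.
Proof.
rewrite /mobius (@mobius_rec_stable _ #|T|.+1) ?max_card //.
by rewrite ltnW // ltnS max_card.
Qed.

End Mobius.

Section Arrangement.
Context {R : realType} {d : nat}.
Local Notation V := 'rV[R]_d.
Implicit Types (H : {fset set V}).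

Definition affine_hyperplane (h : set V) : Prop :=
  exists (a : V) (b : R), a != 0 /\ h = [set x | \sum_(i < d) a 0 i * x 0 i = b].

Definition hyperplane_arrangement H : Prop :=
  forall h, h \in H -> affine_hyperplane h \/ h = setT.

(* [S] may be empty, so the whole space is always a flat. *)
Definition flats H : {fset set V} :=
  [fset u in [fset \bigcap_(h in [set` S]) h | S : {fset set V} in fpowerset H]
     | u != set0]%fset.

Lemma flatsP H (u : set V) :
  reflect (exists S : {fset set V},
             [/\ (S `<=` H)%fset, u = \bigcap_(h in [set` S]) h & u !=set0])
          (u \in flats H).
Proof.
rewrite !inE; apply: (iffP andP) => [[/imfsetP[S /= SH ->] /set0P u0]|].
  by exists S; split => //; rewrite -fpowersetE.
move=> [S [SH -> u0]]; split; last exact/set0P.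
by apply/imfsetP; exists S => //=; rewrite fpowersetE.
Qed.

End Arrangement.

(* L(H), ordered by reverse inclusion. *)
Definition flat {R : realType} {d : nat} (H : {fset set 'rV[R]_d}) : Type :=
  flats H.

Definition set_of_flat {R : realType} {d : nat} {H : {fset set 'rV[R]_d}}
  (u : flat H) : set 'rV[R]_d := @fsval _ (flats H) u.
Coercion set_of_flat : flat >-> set.

Fact flat_display : Order.disp_t. Proof. exact: Order.default_display. Qed.

Section FlatOrder.
Context {R : realType} {d : nat} (H : {fset set 'rV[R]_d}).

HB.instance Definition _ := Finite.copy (flat H) (flats H).

Definition flat_le (u v : flat H) : bool := `[< set_of_flat v `<=` set_of_flat u >].

Lemma flat_le_refl : reflexive flat_le.
Proof. by move=> u; apply/asboolP. Qed.

Lemma flat_le_anti : antisymmetric flat_le.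
Proof.
by move=> u v /andP[/asboolP vu /asboolP uv]; apply: val_inj; apply/seteqP.
Qed.

Lemma flat_le_trans : transitive flat_le.
Proof.
move=> v u w /asboolP vu /asboolP wv; apply/asboolP.
exact: subset_trans wv vu.
Qed.

HB.instance Definition _ := Order.Le_isPOrder.Build flat_display (flat H)
  flat_le_refl flat_le_anti flat_le_trans.

End FlatOrder.

Section Faces.
Context {R : realType} {d : nat}.
Local Notation V := 'rV[R]_d.
Implicit Types (H : {fset set V}) (u A : set V).

Definition induced_arrangement H u : set (set V) :=
  [set h `&` u | h in [set h | h \in H /\ ~ (u `<=` h)]].

Definition complement_in H u : set V :=
  u `\` \bigcup_(k in induced_arrangement H u) k.

Definition open_regions H u : set (set V) :=
  [set connected_component (complement_in H u) x | x in complement_in H u].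

Definition closed_regions H u : set (set V) :=
  [set closure C | C in open_regions H u].

Definition open_faces H : set (set V) :=
  \bigcup_(s in [set: flat H]) open_regions H s.

Definition face_union H A : Prop :=
  exists F : set (set V),
    [/\ finite_set F, F `<=` open_faces H & A = \bigcup_(f in F) f].

(* A valuation is represented by a function on all sets, whose values are
   constrained only on finite unions of open faces. *)
Definition normalized_valuation H (G : zmodType) (v : set V -> G) : Prop :=
  v set0 = 0 /\
  (forall A B, face_union H A -> face_union H B ->
     v (A `|` B) + v (A `&` B) = v A + v B).

(* [\sum_(_ \in _)] is 0 by convention over families of infinite support;
   the family of regions is finite when [H] is an arrangement. *)
Definition region_sum H (G : zmodType) (v : set V -> G) (u : set V) : G :=
  \sum_(C \in closed_regions H u) v C.

End Faces.

(* Main.v *)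
Require Import Defs.
From HB Require Import structures.
From mathcomp Require Import all_boot all_order all_algebra.
From mathcomp Require Import finmap.
From mathcomp Require Import all_classical all_reals all_analysis.
From mathcomp Require Import ring lra.

(** A valuation is additive over open faces, so both sides are integer
combinations of the values of the open faces, and it is enough to compare the
coefficients of the face [F] of a point [x].  On the left the coefficient is
the number [N u x] of regions of the induced arrangement in [u] whose closure
contains [x]; on the right it is the sum of [|mu(u, s)|] over the flats [s]
with [u <= s] and [x] in [s].  Their equality is a local form of Zaslavsky's
theorem, obtained here from three facts.

(1) Euler's relation ([local_euler]).  The open faces that lie in [u] and have
[x] in their closure cut up a relatively open convex neighbourhood of [x] in
[u].  Cutting such a set by one hyperplane either leaves it whole or produces
two pieces of the same dimension and one of dimension one less, so the sum of
[(-1) ^ dim] over the pieces does not change ([euler_char_slice]).  Grouping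
the faces by the flat that they span gives
[\sum_(s >= u) (-1) ^ (dim s) N s x = (-1) ^ (dim u)] when [x] is in [u].

(2) Moebius inversion ([mobius_inversion]), which turns (1) into
[N u x = \sum_s mu(u, s) (-1) ^ (dim u + dim s)], over the [s] with [u <= s]
and [x] in [s].

(3) Rota's sign theorem ([mobius_sign]): [(-1) ^ (dim u + dim t) mu(u, t)] is
nonnegative when [u <= t].  If [u < t], choose a hyperplane [h] of the
arrangement that contains [t] and not [u].  Intersecting with [h] is a closure
operator on the flats below [t], and Rota's identity for closures
([mobius_closure_sum]) expresses [mu(u, t)] as minus the sum of [mu(u, s)] over
the flats [s != t] between [u] and [t] with [s `&` h = t].  Each of those has
dimension exactly one more than [t] ([flat_dim_cap]), so the sign alternates.

The link with topology is that open faces are the classes of points with equal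
sign vectors ([component_cell]), and that the closure of the class of [T]
consists of the points whose sign vector arises from [T] by replacing some
entries by zero ([closure_cell]). *)

Set Implicit Arguments.
Unset Strict Implicit.
Unset Printing Implicit Defensive.

Import Order.TTheory GRing.Theory Num.Theory.
Import numFieldNormedType.Exports.

Local Open Scope classical_set_scope.
Local Open Scope ring_scope.

(** * The Moebius function of a finite poset *)

Section MobiusTheory.
Context {disp : Order.disp_t} {T : finPOrderType disp}.
Implicit Types r s t w u : T.

Lemma mobius_sum r s : (r <= s)%O ->
  \sum_(w : T | (r <= w <= s)%O) mobius r w = (r == s)%:R.
Proof.
move=> rs; rewrite (bigD1 s) /= ?rs ?lexx//.
have -> : \sum_(w : T | (r <= w <= s)%O && (w != s)) mobius r w =
          \sum_(w : T | (r <= w < s)%O) mobius r w.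
  by apply: eq_bigl => w; rewrite -andbA (lt_neqAle w s) [(w != s) && _]andbC.
rewrite [mobius r s]mobiusE; case: eqVneq => [->|nrs].
  by rewrite big_pred0 ?addr0// => w; apply/negP => /andP[/le_lt_trans h /h]; rewrite ltxx.
by rewrite lt_neqAle nrs rs addNr.
Qed.

Lemma mobius_inversion (f g : T -> int) :
  (forall r, f r = \sum_(s : T | (r <= s)%O) g s) ->
  forall r, g r = \sum_(s : T | (r <= s)%O) mobius r s * f s.
Proof.
move=> fE r.
under eq_bigr do rewrite fE mulr_sumr.
rewrite (exchange_big_dep (fun t => r <= t)%O) /=; last first.
  by move=> s t; apply: le_trans.
under eq_bigr => t rt do rewrite -mulr_suml mobius_sum//.
rewrite (bigD1 r)//= eqxx mul1r big1 ?addr0// => t /andP[_ tr].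
by rewrite eq_sym (negPf tr) mul0r.
Qed.

(** Rota's closure identity, for an operator [c] that needs to behave like a
closure only below the elements of [K], since the intersection of a flat with a
hyperplane may be empty.  The sum of [mobius u] from [u] to [t] vanishes; it
splits according to the value of [c], and by induction the part on which
[c s = t'] with [t' < t] vanishes. *)
Lemma mobius_closure_sum (K : pred T) (c : T -> T) u t :
  (forall s t', K t' -> (s <= t')%O -> [/\ (s <= c s)%O, (c s <= t')%O & K (c s)]) ->
  ~~ K u -> K t -> (u <= t)%O ->
  \sum_(s : T | (u <= s <= t)%O && (c s == t)) mobius u s = 0.
Proof.
move=> cP Ku.
have [n] := ubnP #|[pred w | (w < t)%O]|.
elim: n t => [//|n IH] t; rewrite ltnS => tn Kt ut.
have := mobius_sum ut.
have -> : u == t = false by apply: contraNF Ku => /eqP ->.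
rewrite (partition_big c (fun t' => (t' <= t)%O)) /=; last first.
  by move=> s /andP[us st]; have [] := cP s t Kt st.
rewrite (bigD1 t)//= [X in _ + X]big1 ?addr0// => t' /andP[t't nt].
have t'lt : (t' < t)%O by rewrite lt_neqAle nt.
have [/andP[Kt' ut']|KN] := boolP (K t' && (u <= t')%O); last first.
  apply: big_pred0 => s; apply: contraNF KN => /andP[/andP[us st] /eqP <-].
  by have [h1 _ ->] := cP s t Kt st; apply: le_trans h1.
rewrite -[RHS](IH t' _ Kt' ut'); last first.
  apply: leq_trans tn; apply: proper_card; apply/properP; split.
    by apply/fintype.subsetP => x; rewrite !inE => /lt_trans; apply.
  by exists t'; rewrite !inE ?ltxx.
apply: eq_bigl => s; apply/andP/andP => -[/andP[us st] /eqP cs]; split; rewrite ?cs//.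
  by rewrite us -cs; have [] := cP s t Kt st.
by rewrite us (le_trans st).
Qed.

End MobiusTheory.

(** * Euler's relation for a relatively open convex set cut by hyperplanes *)

Section Sign.
Context {R : realDomainType}.
Implicit Types (t : R) (s : option bool).

(** [None] stands for zero and [Some b] for the sign of which [b] says whether
it is positive, so that sign vectors form a finite type. *)
Definition sign t : option bool := if t == 0 then None else Some (0 < t).

Lemma signP t s :
  reflect (match s with None => t = 0 | Some true => 0 < t | Some false => t < 0 end)
          (sign t == s).
Proof.
rewrite /sign; apply: (iffP eqP); case: (ltrgt0P t); case: s => [[]|] //.
all: by move=> h t0; move: h; rewrite t0 ltxx.
Qed.

Lemma sum_sign (F : option bool -> int) :
  \sum_s F s = F (Some true) + F (Some false) + F None.
Proof.
rewrite (bigD1 (Some true))//= (bigD1 (Some false))//= (bigD1 None)//=.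
by rewrite big_pred0 ?addr0 ?addrA// => -[[]|].
Qed.

End Sign.

Lemma common_radius (R : realType) (I : finType) (P : I -> R -> Prop) :
  (forall i, exists2 e : R, 0 < e & forall t, `|t| < e -> P i t) ->
  exists2 e : R, 0 < e & forall t, `|t| < e -> forall i, P i t.
Proof.
move=> eP; suff [e e0 eL] : exists2 e : R, 0 < e &
    forall t, `|t| < e -> forall i, i \in index_enum I -> P i t.
  by exists e => // t te i; apply: eL => //; rewrite mem_index_enum.
elim: (index_enum I) => [|i L [e e0 eL]]; first by exists 1.
have [e' e'0 e'P] := eP i.
exists (Num.min e e'); first by rewrite lt_min e0.
move=> t; rewrite lt_min => /andP[te te'] j; rewrite inE => /orP[/eqP ->|].
  exact: e'P.
exact: eL.
Qed.

Section Euler.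
Context {R : realType} {d : nat}.
Local Notation V := 'rV[R]_d.
Implicit Types (p : V * R) (x y z : V) (D : 'M[R]_d) (C : set V).

(** The pair [p = (a, b)] encodes the affine function [a . x - b], of which
[lin p] is the linear part. *)
Definition lin p z : R := (z *m p.1^T) 0 0.
Definition aff p x : R := lin p x - p.2.

Lemma linD p x y : lin p (x + y) = lin p x + lin p y.
Proof. by rewrite /lin mulmxDl mxE. Qed.

Lemma linZ p t x : lin p (t *: x) = t * lin p x.
Proof. by rewrite /lin -scalemxAl mxE. Qed.

Lemma linB p x y : lin p (x - y) = aff p x - aff p y.
Proof. by rewrite linD -scaleN1r linZ /aff; ring. Qed.

Lemma aff_line p x z t : aff p (x + t *: z) = aff p x + t * lin p z.
Proof. by rewrite /aff linD linZ; ring. Qed.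

Lemma aff_seg p x y t : aff p (x + t *: (y - x)) = (1 - t) * aff p x + t * aff p y.
Proof. by rewrite aff_line linB; ring. Qed.

Lemma sub_ker p z : (z <= kermx p.1^T)%MS <-> lin p z = 0.
Proof.
split=> [/sub_kermxP|] ; rewrite /lin; first by move=> ->; rewrite mxE.
move=> h; apply/sub_kermxP; apply/matrixP => i j.
by rewrite !ord1 h mxE.
Qed.

(** Openness is only asked along lines: every point of [C] can be moved a little
in each direction of the row space of [D].  This is all that
cutting by a hyperplane uses, and the slices inherit it. *)
Definition rel_open_convex D C : Prop :=
  [/\ forall x y, C x -> C y -> (y - x <= D)%MS,
      forall x y t, C x -> C y -> 0 <= t <= 1 -> C (x + t *: (y - x))
    & forall x z, C x -> (z <= D)%MS ->
        exists2 e : R, 0 < e & forall t, `|t| < e -> C (x + t *: z)].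

Definition sign_slice p C (s : option bool) : set V :=
  C `&` [set x | sign (aff p x) = s].

Definition slice_dir p D (s : option bool) : 'M[R]_d :=
  if s is None then (D :&: kermx p.1^T)%MS else D.

Lemma sign_seg (a b t : R) s : sign a = s -> sign b = s -> 0 <= t <= 1 ->
  sign ((1 - t) * a + t * b) = s.
Proof.
move=> /eqP/signP ha /eqP/signP hb /andP[t0 t1]; apply/eqP/signP.
case: s ha hb => [[]|] ha hb; last by rewrite ha hb; ring.
- have [->|t1'] := eqVneq t 1; first by lra.
  have : 0 < (1 - t) * a by rewrite mulr_gt0// subr_gt0 lt_neqAle t1'.
  have : 0 <= t * b by rewrite mulr_ge0// ltW.
  lra.
- have [->|t1'] := eqVneq t 1; first by lra.
  have : (1 - t) * a < 0 by rewrite pmulr_rlt0// subr_gt0 lt_neqAle t1'.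
  have : t * b <= 0 by rewrite mulr_ge0_le0// ltW.
  lra.
Qed.

Lemma sign_perturb (a b : R) : a != 0 ->
  exists2 e : R, 0 < e & forall t, `|t| < e -> sign (a + t * b) = sign a.
Proof.
move=> a0; have b1 : 0 < `|b| + 1 by rewrite ltr_wpDl.
exists (`|a| / (`|b| + 1)); first by rewrite divr_gt0// normr_gt0.
move=> t; rewrite ltr_pdivlMr// => tb.
have h : `|t * b| < `|a|.
  by apply: le_lt_trans tb; rewrite normrM ler_wpM2l// lerDl.
apply/eqP/signP; rewrite /sign (negPf a0).
move: h; case: ltrgt0P a0 => // ha _; first by rewrite ltr_norml => /andP[]; lra.
by rewrite ltr_norml => /andP[]; lra.
Qed.

Lemma rel_open_convex_slice p D C s : rel_open_convex D C ->
  rel_open_convex (slice_dir p D s) (sign_slice p C s).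
Proof.
move=> [CD Cc Co]; split.
- move=> x y [Cx sx] [Cy sy]; have := CD _ _ Cx Cy.
  case: s sx sy => //= sx sy xy; rewrite sub_capmx xy /=.
  apply/sub_ker; rewrite linB.
  by have /eqP/signP -> := sx; have /eqP/signP -> := sy; rewrite subr0.
- move=> x y t [Cx sx] [Cy sy] t01; split; first exact: Cc.
  by rewrite /= aff_seg; apply: sign_seg.
- move=> x z [Cx sx] zD.
  have zD' : (z <= D)%MS by case: s zD {sx} => //=; rewrite sub_capmx => /andP[].
  have [e e0 eC] := Co x z Cx zD'.
  case: s sx zD => [b|] sx zD.
    have fx : aff p x != 0 by move: sx; rewrite /= /sign; case: eqVneq.
    have [e' e'0 e's] := sign_perturb (lin p z) fx.
    exists (Num.min e e'); first by rewrite lt_min e0.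
    move=> t; rewrite lt_min => /andP[te te']; split; first exact: eC.
    by rewrite /= aff_line e's.
  exists e => // t te; split; first exact: eC.
  move: zD; rewrite /= sub_capmx => /andP[_ /sub_ker zp].
  by rewrite aff_line zp mulr0 addr0.
Qed.

(** The compactly supported Euler characteristic of a relatively open convex set
with space of directions [D]. *)
Definition euler_char D C : int := if `[< C !=set0 >] then (-1) ^+ \rank D else 0.

Lemma euler_char_set0 D C : (forall x, ~ C x) -> euler_char D C = 0.
Proof. by move=> h; rewrite /euler_char; case: asboolP => // -[x /h]. Qed.

(** If [aff p] is constant on [C], or has no zero on [C], a single slice is
nonempty and it has the dimension of [C].  Otherwise, moving a zero of [aff p]
both ways along a direction in which it varies shows that all three slices are
nonempty, and the zero slice has one dimension less: two terms of [C]'s sign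
and one of the opposite sign. *)
Lemma euler_char_slice p D C : rel_open_convex D C ->
  euler_char D C = \sum_s euler_char (slice_dir p D s) (sign_slice p C s).
Proof.
move=> [CD Cc Co]; have [[x0 Cx0]|C0] := pselect (C !=set0); last first.
  have Ce x : ~ C x by move=> Cx; apply: C0; exists x.
  by rewrite euler_char_set0// big1// => s _; apply: euler_char_set0 => x [/Ce].
have euler_charN : forall D' C' y, C' y -> euler_char D' C' = (-1) ^+ \rank D'.
  by move=> D' C' y h; rewrite /euler_char; case: asboolP => // -[]; exists y.
rewrite (euler_charN _ _ _ Cx0).
have single s : (forall x, C x -> sign (aff p x) = s) ->
    \rank (slice_dir p D s) = \rank D ->
    (-1) ^+ \rank D = \sum_s euler_char (slice_dir p D s) (sign_slice p C s).
  move=> hs rs; rewrite (bigD1 s)//= big1 ?addr0; last first.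
    move=> s' s's; apply: euler_char_set0 => x [Cx /= sx].
    by move: s's; rewrite -sx hs// eqxx.
  by rewrite (euler_charN _ _ x0) ?rs//; split => //; exact: hs.
have [Dp|Dp] := boolP (D <= kermx p.1^T)%MS.
  apply: (single (sign (aff p x0))).
    move=> x Cx; have := submx_trans (CD _ _ Cx0 Cx) Dp.
    by move=> /sub_ker; rewrite linB => /eqP; rewrite subr_eq0 => /eqP ->.
  case: (sign _) => //=; apply/eqP; rewrite eqn_leq.
  by rewrite !mxrankS ?capmxSl// sub_capmx submx_refl.
have [z zD zp] : exists2 z, (z <= D)%MS & lin p z != 0.
  move/row_subPn : Dp => [i hi]; exists (row i D); first exact: row_sub.
  by apply/eqP => /sub_ker; apply/negP.
have rk : \rank D = (\rank (D :&: kermx p.1^T)%MS).+1.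
  rewrite -[LHS](mxrank_mul_ker D p.1^T) -[RHS]add1n; congr (_ + _)%N.
  apply/eqP; rewrite eqn_leq rank_leq_col lt0n mxrank_eq0; apply/eqP => D0.
  case/submxP : zD => A zA; move: zp; rewrite /lin zA -mulmxA D0 mulmx0 mxE eqxx.
  by [].
have [[x [Cx sx]]|N0] := pselect (sign_slice p C None !=set0).
  have fx : aff p x = 0 by have /eqP/signP := sx.
  have [e e0 eC] := Co x z Cx zD.
  have pt (b : bool) : sign_slice p C (Some b) !=set0.
    have [t te tz] : exists2 t, `|t| < e & sign (t * lin p z) = Some b.
      have h2 : `|e / 2| < e by rewrite gtr0_norm; lra.
      have h2' : `|- (e / 2)| < e by rewrite normrN.
      have [zp0|zp0] : (0 < lin p z) \/ (lin p z < 0) by case: ltrgt0P zp; auto.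
        case: b; [exists (e / 2) | exists (- (e / 2))] => //; apply/eqP/signP.
          by rewrite mulr_gt0//; lra.
        by rewrite mulNr oppr_lt0 mulr_gt0//; lra.
      case: b; [exists (- (e / 2)) | exists (e / 2)] => //; apply/eqP/signP.
        by rewrite mulNr oppr_gt0 pmulr_rlt0//; lra.
      by rewrite pmulr_rlt0//; lra.
    exists (x + t *: z); split; first exact: eC.
    by rewrite /= aff_line fx add0r.
  rewrite sum_sign /= rk.
  have [y Cy] := pt true; rewrite (euler_charN _ _ _ Cy).
  have [y' Cy'] := pt false; rewrite (euler_charN _ _ _ Cy') (euler_charN _ _ x) //.
  by rewrite rk exprS mulN1r subrK.
have fN x : C x -> aff p x != 0.
  by move=> Cx; apply/eqP => fx; apply: N0; exists x; split => //; apply/eqP/signP.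
apply: (single (sign (aff p x0))); last first.
  by rewrite /sign (negPf (fN _ Cx0)).
move=> x Cx; apply/eqP; apply/negPn/negP => sne.
have neg : aff p x0 * aff p x < 0.
  move: sne; rewrite /sign (negPf (fN _ Cx0)) (negPf (fN _ Cx)).
  case: (ltrgt0P (aff p x)) (fN _ Cx) => // hx _;
  case: (ltrgt0P (aff p x0)) (fN _ Cx0) => // hx0 _; nra.
have den : aff p x0 - aff p x != 0 by apply/eqP; nra.
(* The zero of [aff p] on the line through [x0] and [x] *)
apply: N0; exists (x0 + (aff p x0 / (aff p x0 - aff p x)) *: (x - x0)); split.
  apply: Cc => //.
  case: (ltrgt0P (aff p x)) (fN _ Cx) => // hx _;
  case: (ltrgt0P (aff p x0)) (fN _ Cx0) => // hx0 _; try nra.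
    by rewrite mulr_le0 ?invr_le0 ?ler_ndivrMr; lra.
  by rewrite divr_ge0 ?ler_pdivrMr; lra.
by apply/eqP/signP; rewrite aff_seg; field.
Qed.

(** Cutting by the hyperplanes of [L] one at a time.  Sign vectors are kept on
the fixed index type [I] by letting them vanish outside [L]. *)
Lemma euler_seq (I : finType) (p : I -> V * R) (L : seq I) D C :
  uniq L -> rel_open_convex D C ->
  \sum_(X : {ffun I -> option bool} |
      [forall i, (i \notin L) ==> (X i == None)] &&
      `[< exists2 y, C y & forall i, i \in L -> sign (aff (p i) y) = X i >])
    (-1) ^+ \rank (D :&: \bigcap_(i <- L | X i == None) kermx (p i).1^T)%MS
  = euler_char D C.
Proof.
elim: L D C => [|i L IH] D C.
  move=> _ _.
  have [[x Cx]|C0] := pselect (C !=set0); last first.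
    rewrite euler_char_set0 => [|y Cy]; last by apply: C0; exists y.
    apply: big_pred0 => X; apply/negP => /andP[_ /asboolP[y Cy _]].
    by apply: C0; exists y.
  rewrite (big_pred1 [ffun=> None]) => [|X]; last first.
    apply/andP/eqP => [[/forallP X0 _]|->]; last first.
      by split; [apply/forallP => j; rewrite ffunE eqxx | apply/asboolP; exists x].
    by apply/ffunP => j; rewrite ffunE; apply/eqP; have := X0 j.
  rewrite big_nil capmx1 /euler_char.
  by case: asboolP => // -[]; exists x.
move=> /= /andP[iL uL] DC.
rewrite (euler_char_slice (p i) DC) (partition_big (fun X : {ffun _ -> _} => X i) xpredT)//=.
apply: eq_bigr => s _.
rewrite -(IH _ _ uL (rel_open_convex_slice (p i) s DC)).
(* Sign vectors with entry [s] at [i] correspond to those with entry [None] at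
   [i]; the latter are the ones that the induction hypothesis ranges over. *)
pose upd (X : {ffun I -> option bool}) t := [ffun j => if j == i then t else X j].
rewrite (reindex_onto (fun X => upd X s) (fun X => upd X None)) /=; last first.
  move=> X /andP[_ /eqP <-]; apply/ffunP => j.
  by rewrite !ffunE; case: eqVneq => [->|].
have updE X j : j \in L -> upd X s j = X j.
  by rewrite ffunE; case: eqVneq => [->|//]; rewrite (negPf iL).
apply: eq_big => [X|X _].
  apply/idP/idP => [/andP[/andP[/andP[/forallP X0 /asboolP[y Cy yX]] _] /eqP XE]|].
    apply/andP; split.
      apply/forallP => j; apply/implyP => jL; rewrite -XE ffunE.
      case: (eqVneq j i) => // ji; have := X0 j.
      by rewrite inE negb_or ji jL.
    apply/asboolP; exists y.
      split=> //=; rewrite yX ?mem_head//.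
      by rewrite ffunE eqxx.
    by move=> j jL; rewrite yX ?inE ?jL ?orbT// updE.
  move=> /andP[/forallP X0 /asboolP[y [Cy ys] yX]].
  have Xi : X i = None by apply/eqP; have := X0 i; rewrite iL.
  apply/andP; split; [apply/andP; split; [apply/andP; split|]|].
  - apply/forallP => j; apply/implyP; rewrite inE negb_or => /andP[ji jL].
    by rewrite ffunE (negPf ji); have := X0 j; rewrite jL.
  - apply/asboolP; exists y => // j; rewrite inE => /orP[/eqP ->|jL].
      by rewrite ffunE eqxx.
    by rewrite yX// updE.
  - by rewrite ffunE eqxx.
  - by apply/eqP/ffunP => j; rewrite !ffunE; case: eqVneq => [->|].
congr (_ ^+ _); rewrite big_cons ffunE eqxx.
have -> : (\bigcap_(j <- L | upd X s j == None) kermx (p j).1^T)%MS =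
          (\bigcap_(j <- L | X j == None) kermx (p j).1^T)%MS.
  rewrite big_seq_cond [RHS]big_seq_cond; apply: eq_bigl => j.
  by case: (boolP (j \in L)) => //= /updE ->.
by case: s {updE} => //=; rewrite capmxA.
Qed.

Lemma euler_relation (I : finType) (p : I -> V * R) D C :
  rel_open_convex D C -> C !=set0 ->
  \sum_(X : {ffun I -> option bool} |
      `[< exists2 y, C y & [ffun i => sign (aff (p i) y)] = X >])
    (-1) ^+ \rank (D :&: \bigcap_(i | X i == None) kermx (p i).1^T)%MS
  = (-1) ^+ \rank D :> int.
Proof.
move=> DC C0; have := euler_seq p (index_enum_uniq I) DC.
rewrite /euler_char; case: asboolP => // _ <-.
apply: eq_bigl => X; apply/asboolP/andP.
  move=> [y Cy <-]; split; last first.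
    by apply/asboolP; exists y => // i _; rewrite ffunE.
  by apply/forallP => i; rewrite mem_index_enum.
move=> [_ /asboolP[y Cy yX]]; exists y => //.
by apply/ffunP => i; rewrite ffunE yX// mem_index_enum.
Qed.

End Euler.

(** * The poset of flats *)

Section Flats.
Context {R : realType} {d : nat} {H : {fset set 'rV[R]_d}}.
Local Notation V := 'rV[R]_d.
Implicit Types (u s t : flat H) (x y z : V) (h : H).

Lemma flat_leP u s : reflect (set_of_flat s `<=` set_of_flat u) (u <= s)%O.
Proof. exact: asboolP. Qed.

Definition lies_in u h : bool := `[< set_of_flat u `<=` fsval h >].

Lemma in_flatP u x : set_of_flat u x <-> forall h, lies_in u h -> fsval h x.
Proof.
split=> [ux h /asboolP|hx]; first exact.
have /flatsP[S [SH uE _]] := fsvalP u.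
rewrite /set_of_flat uE => h /= hS.
have hH : h \in H by apply: (fsubsetP SH).
apply: (hx [` hH]%fset); apply/asboolP.
by rewrite /set_of_flat uE => y; apply.
Qed.

Lemma flat_nonempty u : set_of_flat u !=set0.
Proof. by have /flatsP[S [_ _]] := fsvalP u. Qed.

(** The point [x] is needed because an empty intersection is not a flat. *)
Lemma flat_exists (P : pred H) x : (forall h, P h -> fsval h x) ->
  exists s : flat H, set_of_flat s = [set y | forall h, P h -> fsval h y].
Proof.
move=> Px.
pose S := [fset fsval h | h : H in P]%fset.
pose A : set V := [set y | forall h, P h -> fsval h y].
have AF : A \in flats H.
  apply/flatsP; exists S; split.
  - by apply/fsubsetP => h /imfsetP[k _ ->]; apply: fsvalP.
  - apply/seteqP; split => [y Ay h /= /imfsetP[k /= Pk ->]|y Sy h Ph].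
      exact: Ay.
    by apply: Sy; apply/imfsetP; exists h.
  - by exists x.
by exists ([` AF]%fset).
Qed.

Lemma lies_in_inj u s : lies_in u =1 lies_in s -> u = s.
Proof.
move=> us; apply: val_inj; apply/seteqP; split => x /in_flatP ux; apply/in_flatP => h.
  by rewrite -us; apply: ux.
by rewrite us; apply: ux.
Qed.

Lemma le_lies_in u s h : (u <= s)%O -> lies_in u h -> lies_in s h.
Proof. by move=> /flat_leP su /asboolP uh; apply/asboolP; apply: subset_trans uh. Qed.

(** The default value [u] is returned when [u] misses [h]. *)
Definition cap_flat (h : H) u : flat H :=
  odflt u [pick t | `[< set_of_flat t = set_of_flat u `&` fsval h >]].

Lemma cap_flatE h u x : set_of_flat u x -> fsval h x ->
  set_of_flat (cap_flat h u) = set_of_flat u `&` fsval h.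
Proof.
move=> ux hx; rewrite /cap_flat; case: pickP => [t /asboolP//|no].
have [|s sE] := @flat_exists [pred k | lies_in u k || (k == h)] x.
  by move=> k /orP[/asboolP|/eqP ->//]; apply.
have /asboolP := no s; case; rewrite sE; apply/seteqP; split => y /=.
  move=> yP; split; last by apply: yP; rewrite eqxx orbT.
  by apply/in_flatP => k uk; apply: yP; rewrite uk.
by move=> [/in_flatP uy hy] k /orP[/uy|/eqP ->].
Qed.

End Flats.

(** * Dimension of flats and the sign of the Moebius function *)

Section Equations.
Context {R : realType} {d : nat} {H : {fset set 'rV[R]_d}}.
Local Notation V := 'rV[R]_d.
Implicit Types (u s t : flat H) (x y z : V) (h : H).

Lemma hyperplane_equations : hyperplane_arrangement H ->
  exists p : H -> V * R, forall h x, fsval h x <-> aff (p h) x = 0.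
Proof.
move=> hH.
suff h1 h : exists q : V * R, forall x, fsval h x <-> aff q x = 0.
  by exists (fun h => projT1 (cid (h1 h))) => h; exact: projT2 (cid (h1 h)).
have [[a [b [_ ->]]]|->] := hH _ (fsvalP h).
  exists (a, b) => x /=; rewrite /aff /lin mxE /=.
  under [in X in _ <-> X]eq_bigr do rewrite mxE mulrC.
  split=> [->|/eqP]; first by rewrite subrr.
  by rewrite subr_eq0 => /eqP.
exists (0, 0) => x; split => // _.
by rewrite /aff /lin /= trmx0 mulmx0 mxE subr0.
Qed.

Context (p : H -> V * R) (pP : forall h x, fsval h x <-> aff (p h) x = 0).

(** The row space of [dirmx u] is the space of directions of [u]. *)
Definition dirmx u : 'M[R]_d := (\bigcap_(h | lies_in u h) kermx (p h).1^T)%MS.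
Definition flat_dim u : nat := \rank (dirmx u).

Lemma dirmxP u x z : set_of_flat u x -> (z <= dirmx u)%MS <-> set_of_flat u (x + z).
Proof.
move=> ux; have aE h : lies_in u h -> aff (p h) (x + z) = lin (p h) z.
  move=> /asboolP uh; have /pP := uh _ ux.
  by rewrite /aff linD addrAC => ->; rewrite add0r.
split=> [/sub_bigcapmxP zu|/in_flatP uxz].
  by apply/in_flatP => h uh; apply/pP; rewrite aE//; apply/sub_ker/zu.
apply/sub_bigcapmxP => h uh; apply/sub_ker; rewrite -aE//.
exact/pP/uxz.
Qed.

Lemma dirmx_sub u s : (u <= s)%O -> (dirmx s <= dirmx u)%MS.
Proof.
by move=> us; apply/sub_bigcapmxP => h uh; apply: bigcapmx_inf (le_lies_in us uh) _.
Qed.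

(** The directions of [t] are the kernel of a nonzero linear form on those of
[s]. *)
Lemma flat_dim_cap s t h : ~~ lies_in s h -> set_of_flat t = set_of_flat s `&` fsval h ->
  flat_dim s = (flat_dim t).+1.
Proof.
move=> /asboolPn sh tE; have [x tx] := flat_nonempty t.
have [sx hx] : set_of_flat s x /\ fsval h x by move: tx; rewrite tE.
have tD : (dirmx t :=: dirmx s :&: kermx (p h).1^T)%MS.
  apply/eqmxP/rV_eqP => z; rewrite sub_capmx; apply/idP/andP.
    move=> /(dirmxP z tx); rewrite tE => -[/(dirmxP z sx) ? hxz]; split => //.
    apply/sub_ker; have -> : z = (x + z) - x by rewrite addrC addKr.
    by rewrite linB; move/pP: hx => ->; move/pP: hxz => ->; rewrite subrr.
  move=> [/(dirmxP z sx) sxz /sub_ker hz]; apply/(dirmxP z tx).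
  rewrite tE; split => //; apply/pP.
  by rewrite /aff linD hz addr0; exact/pP.
rewrite /flat_dim tD -[LHS](mxrank_mul_ker _ (p h).1^T) -[RHS]add1n; congr (_ + _)%N.
apply/eqP; rewrite eqn_leq rank_leq_col lt0n mxrank_eq0; apply/eqP => D0.
apply: sh => y sy; apply/pP.
have /submxP[A yA] : (y - x <= dirmx s)%MS.
  by apply/(dirmxP _ sx); rewrite addrC subrK.
have := linB (p h) y x; rewrite {1}/lin yA -mulmxA D0 mulmx0 mxE.
by move/pP: hx => ->; rewrite subr0 => <-.
Qed.

(** By [mobius_closure_sum] for the intersection with a hyperplane [h] that
contains [t] and not [u], [mobius u t] is minus the sum of [mobius u s] over the
flats [s != t] between [u] and [t] that meet [h] in [t]; their dimensions have
the parity opposite to that of [t]. *)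
Lemma mobius_sign u t : (u <= t)%O -> 0 <= (-1) ^+ (flat_dim u + flat_dim t) * mobius u t.
Proof.
have [n] := ubnP #|[pred w | (w < t)%O]|.
elim: n t => [//|n IH] t; rewrite ltnS => tn ut.
have [<-|nut] := eqVneq u t.
  by rewrite mobiusE eqxx mulr1 -signr_odd addnn odd_double.
(* As sets, [t] is strictly smaller than [u], and both are intersections of
   hyperplanes. *)
have [h th uh] : exists2 h, lies_in t h & ~~ lies_in u h.
  apply: contrapT => no; move/eqP: nut; apply; apply/le_anti; rewrite ut /=.
  apply/flat_leP => x ux; apply/in_flatP => h th.
  apply: contrapT => hx; apply: no; exists h => //.
  by apply/asboolP => /(_ _ ux).
have [z tz] := flat_nonempty t.
have subt s : (s <= t)%O -> set_of_flat s z by move=> /flat_leP; apply.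
have hz : fsval h z by move/asboolP : th; apply.
have cP s t' : lies_in t' h -> (s <= t')%O ->
   [/\ (s <= cap_flat h s)%O, (cap_flat h s <= t')%O & lies_in (cap_flat h s) h].
  move=> t'h st'; have [y t'y] := flat_nonempty t'.
  have sy : set_of_flat s y by move/flat_leP: st'; apply.
  have hy : fsval h y by move/asboolP: t'h; apply.
  have cE := cap_flatE sy hy.
  split.
  - by apply/flat_leP; rewrite cE => ? [].
  - apply/flat_leP; rewrite cE => v t'v; split.
      by move/flat_leP: st'; apply.
    by move/asboolP: t'h; apply.
  - by apply/asboolP; rewrite cE => ? [].
have := mobius_closure_sum cP uh th ut.
have ct : cap_flat h t = t.
  have [h1 h2 _] := cP t t th (lexx _).
  by apply/le_anti; rewrite h1 h2.
rewrite (bigD1 t) /=; last by rewrite ut lexx ct eqxx.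
move/eqP; rewrite addr_eq0 => /eqP ->.
rewrite mulrN -mulNr -mulN1r -exprS mulr_sumr; apply: sumr_ge0 => s.
move=> /andP[/andP[/andP[us st] /eqP cs] nst].
have sE : set_of_flat t = set_of_flat s `&` fsval h.
  by rewrite -cs; apply: (cap_flatE (x := z)) => //; apply: subt.
have sh : ~~ lies_in s h.
  apply: contra nst => /asboolP sh; apply/eqP/le_anti; rewrite st /=.
  by apply/flat_leP => y sy; rewrite sE; split => //; exact: sh.
have -> : (-1) ^+ (flat_dim u + flat_dim t).+1 = (-1) ^+ (flat_dim u + flat_dim s) :> int.
  by rewrite (flat_dim_cap sh sE) addnS.
apply: IH us; apply: leq_trans tn; apply: proper_card; apply/properP; split.
  apply/fintype.subsetP => w; rewrite !inE => ws; exact: lt_le_trans st.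
by exists s; rewrite !inE ?ltxx// lt_neqAle nst.
Qed.

Lemma mobius_abs u t : (u <= t)%O ->
  mobius u t = (-1) ^+ (flat_dim u + flat_dim t) * (`|mobius u t|%N : int).
Proof.
move=> ut; have := mobius_sign ut; have := sqrr_sign int (flat_dim u + flat_dim t).
rewrite abszE -signr_odd; case: (odd _); rewrite ?expr1 ?expr0 ?mulN1r ?mul1r => _.
  by rewrite oppr_ge0 => h; rewrite ler0_norm ?opprK.
by move=> h; rewrite ger0_norm.
Qed.

End Equations.

(** * Sign vectors and the number of regions around a point *)

Section SignVectors.
Context {R : realType} {d : nat} {H : {fset set 'rV[R]_d}}.
Local Notation V := 'rV[R]_d.
Implicit Types (u s t : flat H) (x y z : V) (h : H).
Local Notation signs := {ffun H -> option bool}.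
Implicit Types (X T : signs).
Context (p : H -> V * R) (pP : forall h x, fsval h x <-> aff (p h) x = 0).

Definition sign_vector x : signs := [ffun h => sign (aff (p h) x)].

(** For sign vectors realized by points, this says that the face of [X] lies in
the closure of the face of [T]. *)
Definition face_le X T : bool := [forall h, (X h == None) || (T h == X h)].

(** The sign vectors of the regions of the induced arrangement in [u]: they are
realized in [u] and vanish only where they must. *)
Definition topes u : {set signs} :=
  [set X | `[< exists2 x, set_of_flat u x & sign_vector x = X >]
           && [forall h, lies_in u h == (X h == None)]].

(** By [closure_cell], the number of closed regions in [u] that contain [x] *)
Definition nregions u x : nat := #|[set T in topes u | face_le (sign_vector x) T]|.

Lemma sign_vector_None x h : sign_vector x h = None <-> fsval h x.
Proof. by rewrite ffunE pP; split => [/eqP/signP|/eqP hx]//; apply/eqP/signP/eqP. Qed.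

Lemma face_leP X T : reflect (forall h, X h <> None -> T h = X h) (face_le X T).
Proof.
apply: (iffP forallP) => [XT h /eqP/negPf Xh|XT h].
  by have := XT h; rewrite Xh => /eqP.
by case: eqVneq => //= /eqP/XT ->.
Qed.

Lemma topesP u T : reflect
  (exists2 x, set_of_flat u x & sign_vector x = T /\ forall h, lies_in u h = (T h == None))
  (T \in topes u).
Proof.
rewrite inE; apply: (iffP andP) => [[/asboolP[x ux xT] /forallP Th]|[x ux [xT Th]]].
  by exists x => //; split => // h; exact/eqP.
by split; [apply/asboolP; exists x | apply/forallP => h; rewrite Th].
Qed.

Lemma topes_inj u s T : T \in topes u -> T \in topes s -> u = s.
Proof.
move=> /topesP[_ _ [_ uT]] /topesP[_ _ [_ sT]].
by apply: lies_in_inj => h; rewrite uT sT.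
Qed.

Lemma flat_of_zeros u x y : (forall h, sign_vector x h = None -> sign_vector y h = None) ->
  set_of_flat u x -> set_of_flat u y.
Proof.
move=> xy ux; apply/in_flatP => h uh; apply/sign_vector_None/xy/sign_vector_None.
by move/asboolP: uh; apply.
Qed.

Lemma face_le_None X T h : face_le X T -> T h = None -> X h = None.
Proof.
move=> /face_leP/(_ h) XT Th; apply/eqP; apply/negPn/negP => /eqP Xh.
by apply: (Xh); rewrite -XT.
Qed.

(** The flat spanned by an open face is cut out by the hyperplanes that contain
a given point of that face. *)
Lemma support_flat u y : set_of_flat u y -> exists2 s : flat H, (u <= s)%O &
  sign_vector y \in topes s.
Proof.
move=> uy; have [|s sE] := @flat_exists _ _ H [pred h | sign_vector y h == None] y.
  by move=> h /eqP/sign_vector_None.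
have sy : set_of_flat s y by rewrite sE => h /eqP/sign_vector_None.
exists s.
  apply/flat_leP => x; rewrite sE => xP; apply/in_flatP => h uh.
  by apply: xP; apply/eqP/sign_vector_None; move/asboolP: uh; apply.
apply/topesP; exists y => //; split => // h; apply/asboolP/eqP.
  by move=> sh; apply/sign_vector_None; apply: sh.
by move=> yh x; rewrite sE; apply; apply/eqP.
Qed.

(** The open star of the face of [x] inside [u] is where Euler's relation is
applied; its faces are those of [u] that have [x] in their closure. *)
Lemma star_rel_open_convex u x : set_of_flat u x ->
  rel_open_convex (dirmx p u)
    [set y | set_of_flat u y /\ face_le (sign_vector x) (sign_vector y)].
Proof.
move=> ux; split.
- by move=> y z [uy _] [uz _]; apply/(dirmxP pP _ uy); rewrite addrC subrK.
- move=> y z t [uy /face_leP xy] [uz /face_leP xz] t01; split.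
    apply/(dirmxP pP _ uy)/scalemx_sub/(dirmxP pP _ uy).
    by rewrite addrC subrK.
  apply/face_leP => h hx; have := xy h hx; have := xz h hx.
  rewrite ![sign_vector _ h]ffunE aff_seg => h1 h2; exact: sign_seg.
- move=> y z [uy /face_leP xy] zu.
  have [h|e e0 eP] := @common_radius _ H (fun h (r : R) => sign_vector x h <> None ->
      sign_vector (y + r *: z) h = sign_vector x h).
    have [xh|/eqP xh] := eqVneq (sign_vector x h) None; first by exists 1.
    have yh : aff (p h) y != 0.
      have := xy h xh; rewrite [sign_vector y h]ffunE => sy; apply/eqP => y0.
      by move: sy; rewrite y0 /sign eqxx => /esym.
    have [e e0 eP] := sign_perturb (lin (p h) z) yh.
    exists e => // t te _; rewrite -xy// [sign_vector _ h]ffunE aff_line eP//.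
    by rewrite ffunE.
  exists e => // t te; split; last by apply/face_leP; exact: eP.
  by apply/(dirmxP pP _ uy)/scalemx_sub.
Qed.

(** Euler's relation in the star of [x], its faces being grouped by the flats
that they span *)
Lemma local_euler u x : set_of_flat u x ->
  \sum_(s : flat H | (u <= s)%O) (-1) ^+ flat_dim p s * (nregions s x : int)
    = (-1) ^+ flat_dim p u.
Proof.
move=> ux; have sP := star_rel_open_convex ux.
rewrite -[RHS](euler_relation p sP); last first.
  by exists x; split => //; apply/face_leP.
pose fl X := odflt u [pick s : flat H | X \in topes s].
have flE s X : X \in topes s -> fl X = s.
  rewrite /fl; case: pickP => [s' /topes_inj h /h//|no sX].
  by rewrite no in sX.
rewrite [RHS](partition_big fl (fun s => (u <= s)%O)) /=; last first.
  move=> X /asboolP[y [uy _] <-]; have [s us sy] := support_flat uy.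
  by rewrite (flE s).
apply: eq_bigr => s us.
set A := [set T in topes s | face_le (sign_vector x) T].
transitivity (\sum_(X in A) (-1) ^+ flat_dim p s : int).
  by rewrite sumr_const -mulr_natr natz.
symmetry; apply: eq_big => [X|X].
  rewrite finset.in_set; apply/andP/andP.
    move=> [/asboolP[y [uy xy] <-] /eqP <-]; have [s' us' sy] := support_flat uy.
    by rewrite (flE s').
  move=> [sX xX]; split; last by rewrite (flE s).
  have /topesP[y sy [yX _]] := sX.
  by apply/asboolP; exists y => //; split; [move/flat_leP: us; apply | rewrite yX].
move=> /andP[/asboolP[y [uy xy] <-] /eqP ys].
have [s' us' sy] := support_flat uy.
have ss' : s' = s by rewrite -ys (flE s').
move: sy; rewrite ss' => /topesP[_ _ [_ sy]].
rewrite -(eq_bigl _ _ sy); congr (_ ^+ _).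
have /capmx_idPr h := dirmx_sub p us; by rewrite -[RHS]h.
Qed.

Lemma nregions0 u x : ~ set_of_flat u x -> nregions u x = 0%N.
Proof.
move=> ux; apply/eqP; rewrite cards_eq0; apply/eqP/setP => T.
rewrite finset.in_set [RHS]inE; apply/negP => /andP[/topesP[_ _ [_ uT]] xT].
apply: ux; apply/in_flatP => h uh; apply/sign_vector_None/(face_le_None xT)/eqP.
by rewrite -uT.
Qed.

(** Moebius inversion of [local_euler]; the sign [(-1) ^ (dim u + dim s)] that it
leaves is the sign of [mobius u s]. *)
Lemma nregions_mobius u x :
  nregions u x = (\sum_(s : flat H | (u <= s)%O && `[< set_of_flat s x >])
                    `|mobius u s|)%N.
Proof.
(* The identity of [local_euler], extended by zero to the flats that miss [x],
   holds at every flat, as inversion requires. *)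
pose f s : int := if `[< set_of_flat s x >] then (-1) ^+ flat_dim p s else 0.
have fE s : f s = \sum_(t : flat H | (s <= t)%O) (-1) ^+ flat_dim p t * (nregions t x : int).
  rewrite /f; case: asboolP => sx; first by rewrite local_euler.
  rewrite big1// => t /flat_leP ts; rewrite nregions0 ?mulr0//.
  by move=> tx; apply/sx/ts.
have := mobius_inversion fE u.
move=> /(congr1 (fun n => (-1) ^+ flat_dim p u * n)).
rewrite mulrA -expr2 sqrr_sign mul1r mulr_sumr => nE.
apply/eqP; rewrite -eqz_nat nE; apply/eqP.
rewrite (big_morph Posz PoszD (erefl : Posz 0 = 0)) [RHS]big_mkcondr /=.
apply: eq_bigr => s us; rewrite /f; case: asboolP => sx; last by rewrite !mulr0.
rewrite {1}(mobius_abs pP us) exprD.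
set a := (-1) ^+ _; set b := (-1) ^+ _; set n := Posz _.
have aa : a * a = 1 by rewrite -expr2 sqrr_sign.
have bb : b * b = 1 by rewrite -expr2 sqrr_sign.
by rewrite !mulrA aa mul1r mulrAC bb mul1r.
Qed.

End SignVectors.

(** * Regions as cells of sign vectors *)

Lemma aff_continuous (R : realType) (d : nat) (p : 'rV[R]_d * R) : continuous (aff p).
Proof.
have lin_cont : continuous (lin p : 'rV[R]_d -> R).
  rewrite (_ : lin p = fun y : 'rV[R]_d => \sum_j y 0 j * p.1^T j 0); last first.
    by apply/funext => y; rewrite /lin mxE.
  apply: (@continuous_big R _ +%R 0 xpredT) => [|j _ x]; first exact: add_continuous.
  apply: (@continuousM _ _ (fun y : 'rV[R]_d => y 0 j)); last exact: cst_continuous.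
  exact: coord_continuous.
move=> x; apply: (@continuousB _ _ _ (lin p : 'rV[R]_d -> R)); first exact: lin_cont.
exact: cst_continuous.
Qed.

Lemma line_continuous (R : realType) (d : nat) (x z : 'rV[R]_d) :
  continuous (fun t : R => x + t *: z).
Proof.
by move=> t; apply: cvgD; [exact: cvg_cst | exact: scalel_continuous].
Qed.

Section Regions.
Context {R : realType} {d : nat} {H : {fset set 'rV[R]_d}}.
Local Notation V := 'rV[R]_d.
Implicit Types (u s : flat H) (x y z : V) (h : H).
Local Notation signs := {ffun H -> option bool}.
Implicit Types (X T : signs).
Context (p : H -> V * R) (pP : forall h x, fsval h x <-> aff (p h) x = 0).

Definition cell T : set V := [set x | sign_vector p x = T].

Lemma cell_seg X T x y (t : R) : face_le X T -> cell X x -> cell T y -> 0 < t <= 1 ->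
  cell T (x + t *: (y - x)).
Proof.
move=> /face_leP XT xX yT /andP[t0 t1]; apply/ffunP => h.
have Th : sign (aff (p h) y) = T h by rewrite -yT ffunE.
have Xh : sign (aff (p h) x) = X h by rewrite -xX ffunE.
rewrite ffunE aff_seg; have [X0|/eqP X0] := eqVneq (X h) None.
  move: Xh; rewrite X0 => /eqP/signP ->; rewrite mulr0 add0r -Th.
  apply/eqP; rewrite /sign mulf_eq0 gt_eqF//= pmulr_rgt0//.
by apply: sign_seg; rewrite ?t1 ?(ltW t0)// Xh XT.
Qed.

Lemma complement_inP u x : complement_in H u x <->
  set_of_flat u x /\ sign_vector p x \in topes p u.
Proof.
split=> [[ux nx]|[ux /topesP[_ _ [_ xT]]]].
  split=> //; apply/topesP; exists x => //; split => // h.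
  apply/asboolP/eqP => [uh|/(sign_vector_None pP) hx]; first exact/(sign_vector_None pP)/uh.
  apply: contrapT => uh; apply: nx; exists (fsval h `&` set_of_flat u) => //.
  by exists (fsval h) => //; split => //; apply: fsvalP.
split=> // -[_ [k [kH uk] <-] [kx _]].
apply: uk; apply/asboolP; have := xT [` kH]%fset; rewrite /lies_in /= => ->.
exact/eqP/(sign_vector_None pP).
Qed.

(** A cell is convex, hence connected.  Conversely a connected set on which the
sign of some [aff (p h)] changes meets [h] by the intermediate value theorem,
and so leaves the complement unless [h] contains [u], when the sign is zero
throughout. *)
Lemma component_cell u x : complement_in H u x ->
  connected_component (complement_in H u) x = cell (sign_vector p x).
Proof.
move=> cx; have [ux xT] := (complement_inP u x).1 cx.
apply/seteqP; split=> [y [C [Cx Cu Cc] Cy]|y yx].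
  apply/ffunP => h; apply/eqP; apply/negPn/negP => sne.
  have Ch : ~ exists2 z, C z & aff (p h) z = 0.
    move=> [z Cz /pP /(sign_vector_None pP) zh].
    have uh : lies_in u h.
      by have /complement_inP[_ /topesP[_ _ [_ ->]]] := Cu _ Cz; apply/eqP.
    have /complement_inP[_ /topesP[_ _ [_ hy]]] := Cu _ Cy.
    have /complement_inP[_ /topesP[_ _ [_ hx]]] := Cu _ Cx.
    by move: sne; have := hy h; have := hx h; rewrite uh => /esym/eqP -> /esym/eqP ->.
  have : connected (aff (p h) @` C).
    apply: connected_continuous_connected => //.
    exact/continuous_subspaceT/aff_continuous.
  move=> /connected_intervalP Ih.
  have [x0 y0] : aff (p h) x != 0 /\ aff (p h) y != 0.
    by split; apply/eqP => f0; apply: Ch; [exists x | exists y].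
  suff [z Cz z0] : (aff (p h) @` C) 0 by apply: Ch; exists z.
  have Ix : (aff (p h) @` C) (aff (p h) x) by exists x.
  have Iy : (aff (p h) @` C) (aff (p h) y) by exists y.
  move: sne; rewrite !ffunE /sign (negPf x0) (negPf y0).
  case: (ltrgt0P (aff (p h) x)) x0 => // hx _;
  case: (ltrgt0P (aff (p h) y)) y0 => // hy _ _.
    by apply: (Ih _ _ Iy Ix); rewrite !ltW.
  by apply: (Ih _ _ Ix Iy); rewrite !ltW.
apply: (connected_component_max (B := (fun t : R => x + t *: (y - x)) @` `[0, 1])).
- by exists 0; rewrite ?scale0r ?addr0//= in_itv/= lexx ler01.
- move=> _ [t /= t01 <-]; move: t01; rewrite in_itv /= => /andP[t0 t1].
  have tx : cell (sign_vector p x) (x + t *: (y - x)).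
    have [->|t0'] := eqVneq t 0; first by rewrite scale0r addr0.
    apply: (cell_seg (X := sign_vector p x)) => //; first exact/face_leP.
    by rewrite t1 lt_neqAle eq_sym t0' t0.
  apply/complement_inP; rewrite tx; split => //.
  by apply: (flat_of_zeros pP) ux => h; rewrite tx.
- apply: connected_continuous_connected; first exact: segment_connected.
  exact/continuous_subspaceT/line_continuous.
- by exists 1; rewrite ?scale1r/= ?in_itv/= ?lexx ?ler01// addrC subrK.
Qed.

Lemma open_regionsE u : open_regions H u = cell @` [set` topes p u].
Proof.
apply/seteqP; split=> [_ [x cx <-]|_ [T /= uT <-]].
  by rewrite component_cell//; exists (sign_vector p x) => //; have [] := (complement_inP u x).1 cx.
have /topesP[x ux [xT _]] := uT.
have cx : complement_in H u x by apply/complement_inP; rewrite xT.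
by exists x => //; rewrite component_cell// xT.
Qed.

(** Strict signs persist near a point, so a limit of the cell of [T] can only
have lost nonzero signs.  Conversely, if [x] satisfies the weak inequalities,
all points of the segment from [x] to [y], except perhaps [x], lie in the
cell. *)
Lemma closure_cell T y : cell T y ->
  closure (cell T) = [set x | face_le (sign_vector p x) T].
Proof.
move=> Ty; apply/seteqP; split=> x.
  move=> cx; apply/face_leP => h; rewrite ffunE => xh.
  have : nbhs x [set z | sign (aff (p h) z) = sign (aff (p h) x)].
    apply: (@aff_continuous _ _ (p h) x [set a | sign a = sign (aff (p h) x)]).
    move: xh; set a := aff (p h) x; rewrite {1}/sign.
    case: (ltrgt0P a) => // a0 _.
      apply: filterS (open_nbhs_nbhs (conj (@open_gt _ 0) a0)) => b /= b0.
      by apply/eqP/signP; rewrite /sign gt_eqF// a0.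
    apply: filterS (open_nbhs_nbhs (conj (@open_lt _ 0) a0)) => b /= b0.
    by apply/eqP/signP; rewrite /sign lt_eqF// (lt_gtF a0).
  by move=> /cx [z [zT /= <-]]; rewrite -zT ffunE.
move=> xT B xB.
have : nbhs (0 : R) [set t : R | B (x + t *: (y - x))].
  apply: (@line_continuous _ _ x (y - x) 0).
  by rewrite scale0r addr0.
move=> /nbhs_ballP[e /= e0 eB].
pose t := Num.min (e / 2) 1.
have t0 : 0 < t by rewrite lt_min ltr01 divr_gt0.
exists (x + t *: (y - x)); split.
  by apply: (cell_seg xT) => //; rewrite t0 ge_min lexx orbT.
apply: eB; rewrite /ball /= sub0r normrN gtr0_norm// gt_min.
by rewrite ltr_pdivrMr// ltr_pMr// ltr1n.
Qed.

Lemma closure_cell_inj T T' x y : cell T x -> cell T' y ->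
  closure (cell T) = closure (cell T') -> T = T'.
Proof.
move=> Tx T'y; rewrite (closure_cell Tx) (closure_cell T'y) => TT.
have xT' : face_le T T'.
  by have : [set z | face_le (sign_vector p z) T] x; [rewrite /= Tx; apply/face_leP |
     rewrite TT /= Tx].
have yT : face_le T' T.
  by have : [set z | face_le (sign_vector p z) T'] y; [rewrite /= T'y; apply/face_leP |
     rewrite -TT /= T'y].
apply/ffunP => h; case Th: (T h) => [b|].
  by move/face_leP: xT' => ->; rewrite Th.
by apply/esym/(face_le_None yT).
Qed.

(** * Summing the valuation *)

(** Sign vectors that are not realized have an empty cell, which is not an open
face; they must be discarded from the family. *)
Lemma face_union_cells (K : pred signs) : face_union H [set x | K (sign_vector p x)].
Proof.
exists (cell @` [set T | K T /\ cell T !=set0]); split.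
- by apply: finite_image; exact: finite_finset.
- move=> _ [T /= [_ [x xT]] <-].
  have [|s sE] := @flat_exists _ _ H pred0 x; first by [].
  have sx : set_of_flat s x by rewrite sE.
  have [u _ uT] := support_flat pP sx.
  by exists u => //; rewrite open_regionsE; exists T => //=; rewrite -xT.
- apply/seteqP; split=> [x Kx|x [_ [T /= [KT _] <-] /= ->//]].
  exists (cell (sign_vector p x)) => //; exists (sign_vector p x) => //; split => //.
  by exists x.
Qed.

Lemma valuation_cells (G : zmodType) (v : set V -> G) (K : pred signs) :
  normalized_valuation H v ->
  v [set x | K (sign_vector p x)] = \sum_(T | K T) v (cell T).
Proof.
move=> [v0 vU].
have vL (L : seq signs) : uniq L -> v [set x | sign_vector p x \in L] = \sum_(T <- L) v (cell T).
  elim: L => [|T L IH] /=.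
    rewrite big_nil (_ : [set x | _] = set0) //; by apply/seteqP; split.
  move=> /andP[TL uL]; rewrite big_cons -IH//.
  have := vU _ _ (face_union_cells (pred1 T)) (face_union_cells (mem L)).
  rewrite [X in v X + _](_ : _ = [set x | sign_vector p x \in T :: L]); last first.
    by apply/seteqP; split=> x /=; rewrite inE => /orP.
  rewrite [X in _ + v X](_ : _ = set0); last first.
    by apply/seteqP; split=> // x [/= /eqP -> h]; move: TL; rewrite h.
  rewrite v0 addr0 => ->; congr (v _ + _).
  by apply/seteqP; split=> x /eqP.
rewrite -big_enum -vL ?enum_uniq//; congr (v _).
by apply/seteqP; split=> x /=; rewrite mem_enum.
Qed.

(** Each closed region is the union of the cells below its sign vector;
exchanging the two sums counts, for each cell, the regions whose closure
contains it. *)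
Lemma region_sum_cells (G : zmodType) (v : set V -> G) u :
  normalized_valuation H v ->
  region_sum H v u = \sum_X v (cell X) *+ #|[set T in topes p u | face_le X T]|.
Proof.
move=> hv.
have wit T : T \in topes p u -> exists x, cell T x.
  by move=> /topesP[x _ [xT _]]; exists x.
have -> : region_sum H v u = \sum_(T in topes p u) v (closure (cell T)).
  rewrite /region_sum (_ : closed_regions H u =
      (fun T => closure (cell T)) @` [set` enum (topes p u)]); last first.
    rewrite /closed_regions open_regionsE image_comp.
    suff -> : [set` enum (topes p u)] = [set` topes p u] by [].
    by apply/seteqP; split=> T /=; rewrite mem_enum.
  rewrite fsbig_image; last first.
    move=> T T'; rewrite !inE /= !mem_enum => /wit[x Tx] /wit[y T'y].
    exact: closure_cell_inj Tx T'y.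
  by rewrite -fsbig_seq ?enum_uniq// big_enum.
under eq_bigr => T /wit[y Ty].
  rewrite (closure_cell Ty) (valuation_cells (fun X => face_le X T) hv).
  over.
rewrite (exchange_big_dep xpredT) //=; apply: eq_bigr => X _.
rewrite -sumr_const; apply: eq_bigl => T.
by rewrite finset.in_set.
Qed.

Lemma flat_cells (G : zmodType) (v : set V -> G) s :
  normalized_valuation H v ->
  v s = \sum_(X : signs | [forall h, lies_in s h ==> (X h == None)]) v (cell X).
Proof.
move=> hv; rewrite -valuation_cells//; congr (v _); apply/seteqP; split => x /=.
  move=> sx; apply/forallP => h; apply/implyP => sh; apply/eqP/(sign_vector_None pP).
  by move/asboolP: sh; apply.
move=> /forallP xs; apply/in_flatP => h sh; apply/(sign_vector_None pP)/eqP.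
by have := xs h; rewrite sh.
Qed.

End Regions.

Theorem theorem9p1 (R : realType) (d : nat) (H : {fset set 'rV[R]_d})
  (hH : hyperplane_arrangement H) (u : flat H)
  (G : zmodType) (v : set 'rV[R]_d -> G) (hv : normalized_valuation H v) :
  region_sum H v u =
  \sum_(s : flat H | (u <= s)%O) v s *+ `|mobius u s|%N.
Proof.
have [p pP] := hyperplane_equations hH.
rewrite (region_sum_cells pP)//.
under [RHS]eq_bigr do rewrite (flat_cells pP)// -sumrMnl.
rewrite (exchange_big_dep xpredT)//=; apply: eq_bigr => X _.
rewrite sumrMnr.
have [[x xX]|X0] := pselect (cell p X !=set0); last first.
  suff -> : cell p X = set0 by rewrite hv.1 !mul0rn.
  by apply/seteqP; split => // x Xx; apply: X0; exists x.
congr (_ *+ _); rewrite -xX -/(nregions p u x) (nregions_mobius pP).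
apply: eq_bigl => s; congr (_ && _); apply/asboolP/forallP.
  move=> sx h; apply/implyP => sh; apply/eqP/(sign_vector_None pP).
  by move/asboolP: sh; apply.
move=> xs; apply/in_flatP => h sh; apply/(sign_vector_None pP)/eqP.
by have := xs h; rewrite sh.
Qed.
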